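(* Assume that Artin's conjecture fails at $s_0$, with the characters ordered so that, for integers $1\le p<q\le r$, one has $\ell_1,\ldots,\ell_p>0$, $\ell_{p+1},\ldots,\ell_q<0$, $\ell_{q+1}=\cdots=\ell_r=0$. Assume that $f_{p+1},\ldots,f_q$ have simple poles at $s_0$. Then $$\mathbb F[H(s_0)]=\mathbb F[x_{q+1},\ldots,x_r,\ x_jv\;:\;1\le j\le p,\ v\text{ a monomial},\ \operatorname{supp}(v)\subset\{x_{p+1},\ldots,x_q\},\ \deg(v)\le\ell_j].$$
   Context: Let $K/\mathbb Q$ be a finite Galois extension with Galois group $G$, let $\chi_1,\ldots,\chi_r$ be the irreducible complex characters of $G$, and let $f_j(s)=L(s,\chi_j,K/\mathbb Q)$, $1\le j\le r$, be their Artin L-functions (meromorphic on $\mathbb C$). Fix $s_0\in\mathbb C\setminus\{1\}$ and let $\ell_j:=\operatorname{ord}_{s=s_0}f_j\in\mathbb Z$ be the order of $s_0$ as a zero of $f_j$ (negative if $f_j$ has a pole at $s_0$). Artin's conjecture at $s_0$ is the statement that $f_1,\ldots,f_r$ are all holomorphic at $s_0$; if it fails, some $\ell_j$ is negative and some $\ell_j$ is positive (because the Dedekind zeta function $\zeta_K=\prod_j f_j^{\chi_j(1)}$ is holomorphic at $s_0$), so an ordering as in the claim exists. Let $\mathbb F$ be a field with $\mathbb C\subseteq\mathbb F\subseteq\mathcal M_{<1}$, where $\mathcal M_{<1}$ is the field of meromorphic functions on $\mathbb C$ of order $<1$. Let $H(s_0)$ be the set of $(a_1,\ldots,a_r)\in\mathbb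 N^r$ (with $0\in\mathbb N$) such that $f_1^{a_1}\cdots f_r^{a_r}$ is holomorphic at $s_0$, i.e. $H(s_0)=\{a\in\mathbb N^r: a_1\ell_1+\cdots+a_r\ell_r\ge 0\}$. Let $\mathbb F[H(s_0)]\subseteq\mathbb F[x_1,\ldots,x_r]$ be the $\mathbb F$-subalgebra spanned by the monomials $x_1^{a_1}\cdots x_r^{a_r}$ with $(a_1,\ldots,a_r)\in H(s_0)$. The support of a monomial $v$ is $\operatorname{supp}(v):=\{x_j: x_j\mid v\}$ (so $v=1$ has empty support), and $\deg(v)$ is its total degree. *)

(* Defs.v *)
From HB Require Import structures.
From mathcomp Require Import all_boot all_order all_algebra all_fingroup.
From mathcomp Require Import all_solvable all_field all_character.
From mathcomp Require Import all_classical all_reals all_analysis.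
From mathcomp Require Import complex.
(* The notations of mpoly clash with those of mathcomp-analysis. *)
From mathcomp.multinomials Require Import -(notations) mpoly.

Set Implicit Arguments.
Unset Strict Implicit.
Unset Printing Implicit Defensive.

Import Order.TTheory GRing.Theory Num.Theory.
Import numFieldNormedType.Exports.

Local Open Scope classical_set_scope.
Local Open Scope ring_scope.

(* R[i] read through its numFieldType structure, which carries the topology of
   the norm; the concrete type R[i] has no topology declared in its own right. *)
Notation Cx R := (Num.NumField.sort (complex_complex__canonical__Num_NumField R)).

Definition cmod (R : realType) (z : Cx R) : R := ComplexField.Normc.normc z.

Definition cexp (R : realType) (z : Cx R) : Cx R :=
  Complex (expR (complex.Re z) * cos (complex.Im z))
          (expR (complex.Re z) * sin (complex.Im z)).

(* n ^ (-s) *)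
Definition npow_neg (R : realType) (n : nat) (s : Cx R) : Cx R :=
  cexp (- (s * Complex (ln (n%:R : R)) 0)).

(** * Meromorphic functions

  A meromorphic function is represented by a total function whose values at
  its poles are irrelevant; accordingly, functions are compared on punctured
  neighbourhoods only. *)

Definition holomorphic_at (R : realType) (g : Cx R -> Cx R) (z : Cx R) : Prop :=
  \forall w \near z, derivable g w 1.

Definition meromorphic_at (R : realType) (f : Cx R -> Cx R) (z : Cx R) : Prop :=
  exists (n : nat) (g : Cx R -> Cx R), holomorphic_at g z /\
    \forall w \near z^', (w - z) ^+ n * f w = g w.

Definition meromorphic (R : realType) (f : Cx R -> Cx R) : Prop :=
  forall z, meromorphic_at f z.

Definition mero_eq (R : realType) (f g : Cx R -> Cx R) : Prop :=
  forall z, \forall w \near z^', f w = g w.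

(* Holomorphy of a meromorphic function at z, i.e. up to a removable
   singularity. *)
Definition mero_holomorphic_at (R : realType) (f : Cx R -> Cx R) (z : Cx R) :
    Prop :=
  exists g : Cx R -> Cx R, holomorphic_at g z /\
    \forall w \near z^', f w = g w.

(* f has order l at z as a zero (a pole of order - l when l < 0). *)
Definition order_at (R : realType) (f : Cx R -> Cx R) (z : Cx R) (l : int) :
    Prop :=
  exists g : Cx R -> Cx R, [/\ holomorphic_at g z, g z != 0 &
    \forall w \near z^', f w = (w - z) ^ l * g w].

Definition simple_pole (R : realType) (f : Cx R -> Cx R) (z : Cx R) : Prop :=
  order_at f z (-1).

(** * Order of growth, by the Nevanlinna characteristic *)

(* Multiplicity of z as a pole, 0 if z is not a pole. *)
Definition pole_mult (R : realType) (f : Cx R -> Cx R) (z : Cx R) : nat :=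
  xget 0%N [set n : nat | order_at f z (- n%:Z)].

(* n(t, f) *)
Definition pole_count (R : realType) (f : Cx R -> Cx R) (t : R) : R :=
  \sum_(z \in [set z : Cx R | cmod z <= t]) ((pole_mult f z)%:R : R).

(* N(t, f) *)
Definition nev_counting (R : realType) (f : Cx R -> Cx R) (t : R) : R :=
  Rintegral lebesgue_measure `[0, t]
    (fun u : R => (pole_count f u - pole_count f 0) / u)
  + pole_count f 0 * ln t.

(* m(t, f) *)
Definition nev_proximity (R : realType) (f : Cx R -> Cx R) (t : R) : R :=
  (2 * pi)^-1 * Rintegral lebesgue_measure `[0, 2 * pi]
    (fun u : R =>
      ln (Num.max 1 (cmod (f (Complex (t * cos u) (t * sin u)))))).

Definition nev_char (R : realType) (f : Cx R -> Cx R) (t : R) : R :=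
  nev_proximity f t + nev_counting f t.

(* limsup of log^+ T(t, f) / log t as t tends to +oo *)
Definition growth_order (R : realType) (f : Cx R -> Cx R) : \bar R :=
  limf_esup (fun t : R => (ln (Num.max 1 (nev_char f t)) / ln t)%:E)
    (pinfty_nbhs R).

(* ev realizes the abstract field F as a field of meromorphic functions of
   order < 1 which contains the constants.  It is injective modulo mero_eq, as
   F is a field and ev 1 is not 0. *)
Record mero_subfield_lt1 (R : realType) (F : fieldType)
    (ev : F -> Cx R -> Cx R) : Prop := MeroSubfield {
  mero_subfield_mero : forall a, meromorphic (ev a);
  mero_subfield_order : forall a, (growth_order (ev a) < 1)%E;
  mero_subfield1 : mero_eq (ev 1) (fun _ => 1);
  mero_subfieldD : forall a b,
    mero_eq (ev (a + b)) (fun s => ev a s + ev b s);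
  mero_subfieldM : forall a b,
    mero_eq (ev (a * b)) (fun s => ev a s * ev b s);
  mero_subfieldC : forall c : Cx R, exists a, mero_eq (ev a) (fun _ => c)
}.

(** * Artin L-functions of a finite Galois extension of the rationals *)

Notation galQ K := ('Gal({:K} / 1)%G).

Definition int_ring (K : splittingFieldType rat) : set K :=
  [set x : K | integralOver (fun n : int => n%:~R : K) x].
Arguments int_ring K : clear implicits.

(* P is a prime ideal of the ring of integers of K, and P contains p. *)
Record prime_above (K : splittingFieldType rat) (p : nat) (P : set K) : Prop :=
  PrimeAbove {
  prime_above_sub : P `<=` int_ring K;
  prime_above0 : P 0;
  prime_aboveB : forall x y, P x -> P y -> P (x - y);
  prime_aboveM : forall a x, int_ring K a -> P x -> P (a * x);
  prime_above1 : ~ P 1;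
  prime_above_prime : forall a b, int_ring K a -> int_ring K b ->
    P (a * b) -> P a \/ P b;
  prime_above_p : P p%:R
}.

Definition inertia_group (K : splittingFieldType rat) (P : set K) :
    {set gal_of {:K}} :=
  [set g in galQ K | `[< forall x, int_ring K x -> P (g x - x) >]].

(* Over the rationals the norm of the prime below P is p, so the condition
   pins down g modulo the inertia group. *)
Definition is_frobenius (K : splittingFieldType rat) (p : nat) (P : set K)
    (g : gal_of {:K}) : Prop :=
  g \in galQ K /\ forall x, int_ring K x -> P (g x - x ^+ p).

(* det (1 - p^(-s) rho(g) | V^I)^-1, with I the inertia group of P.  Products
   in gal_of and row-vector modules are both written left to right, so
   v |-> v *m rG g is a left representation for the usual composition. *)
Definition euler_factor (R : realType) (K : splittingFieldType rat) (n : nat)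
    (rG : mx_representation (Cx R) (galQ K) n)
    (p : nat) (P : set K) (g : gal_of {:K}) (s : Cx R) : Cx R :=
  (\det (1%:M - npow_neg p s *: restrict (rfix_mx rG (inertia_group P)) (rG g)))^-1.

Definition affords (R : realType) (K : splittingFieldType rat) (n : nat)
    (rG : mx_representation (Cx R) (galQ K) n)
    (chi : {ffun gal_of {:K} -> Cx R}) : Prop :=
  forall g, g \in galQ K -> chi g = \tr (rG g).

Definition irr_complex_chars (R : realType) (K : splittingFieldType rat) :
    set {ffun gal_of {:K} -> Cx R} :=
  [set chi | exists (n : nat) (rG : mx_representation (Cx R) (galQ K) n),
    mx_irreducible rG /\ affords rG chi].
Arguments irr_complex_chars R K : clear implicits.

(* f is the meromorphic continuation of the Euler product L(s, chi, K/Q); the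
   Euler factors do not depend on the chosen primes P p and Frobenius elements
   phi p, nor on the choice of the representation affording chi. *)
Definition is_artin_L (R : realType) (K : splittingFieldType rat)
    (chi : {ffun gal_of {:K} -> Cx R}) (f : Cx R -> Cx R) : Prop :=
  meromorphic f /\
  exists (n : nat) (rG : mx_representation (Cx R) (galQ K) n)
         (P : nat -> set K) (phi : nat -> gal_of {:K}),
    [/\ affords rG chi,
        forall p, prime p ->
          prime_above p (P p) /\ is_frobenius p (P p) (phi p) &
        forall s : Cx R, 1 < complex.Re s ->
          (fun N : nat => \prod_(0 <= p < N | prime p)
             euler_factor rG p (P p) (phi p) s) @ \oo --> f s].

(** * The semigroup H(s0) and subalgebras of polynomial rings *)

Notation monom r := (multinom r).
Notation mpolyring r F := (mpoly r F).
Notation mvar F j := (mpolyX F (mnm1 j)).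
Notation mmono F m := (mpolyX F m).

Definition H_set (R : realType) (r : nat) (f : 'I_r -> Cx R -> Cx R)
    (s0 : Cx R) : set (monom r) :=
  [set a : monom r | mero_holomorphic_at (fun s => \prod_(j < r) f j s ^+ a j) s0].

Definition mon_supp (r : nat) (m : monom r) : {set 'I_r} :=
  [set j | (0 < m j)%N].

Definition lin_span (F : fieldType) (V : lmodType F) (X : set V) : set V :=
  smallest (fun A : set V => GRing.submod_closed (mem A)) X.

Definition gen_subalg (F : fieldType) (r : nat) (X : set (mpolyring r F)) :
    set (mpolyring r F) :=
  smallest (fun A : set (mpolyring r F) => GRing.subalg_closed (mem A)) X.

(* F[H]; it is a subalgebra as soon as H is a submonoid of N^r. *)
Definition monoid_alg (F : fieldType) (r : nat) (H : set (monom r)) :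
    set (mpolyring r F) :=
  lin_span [set mmono F a | a in H].
Arguments monoid_alg F {r} H.

(* Main.v *)
Require Import Defs.
From mathcomp Require Import all_boot all_order all_algebra all_fingroup.
From mathcomp Require Import all_solvable all_field all_character.
From mathcomp Require Import all_classical all_reals all_analysis.
From mathcomp Require Import complex.
From mathcomp.multinomials Require Import -(notations) mpoly.
From mathcomp Require Import zify.

Set Implicit Arguments.
Unset Strict Implicit.
Unset Printing Implicit Defensive.

Import Order.TTheory GRing.Theory Num.Theory.
Import numFieldNormedType.Exports.

Local Open Scope classical_set_scope.
Local Open Scope ring_scope.

(** The order at s0 is additive on products, so f^a has order
    a_1 l_1 + ... + a_r l_r (order_at_prod), and a meromorphic function is
    holomorphic exactly when its order is nonnegative (mero_holomorphic_atP).
    Hence H(s0) is the monoid of exponents on which the linear form with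
    coefficients l_j is nonnegative (H_set_weight).

    When the poles are simple the negative l_j all equal -1, the order being
    unique (order_at_unique).  Then an exponent a of H(s0) decomposes greedily.
    Unit vectors e_k with l_k = 0 are removed freely.  If a_j > 0 for some j with
    l_j > 0, one removes e_j along with as many as possible, at most l_j, of the
    negative unit vectors occurring in a; the rest stays in H(s0), because these
    vectors compensate l_j exactly unless they are the whole negative part of a.
    If neither kind of coordinate is left, nonnegativity forces a = 0.  So the
    exponents of the generators in the statement generate the monoid H(s0)
    (weight_monoid_ind), and passing to monomials, which span F[H(s0)], gives the
    equality of algebras. *)

(** * Orders of meromorphic functions *)

(* The field of complex numbers as a numFieldType, of which Cx R is the carrier. *)
Notation CxF R := (complex_complex__canonical__Num_NumField R).

Lemma holomorphicM {R : realType} (g h : Cx R -> Cx R) z :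
  holomorphic_at g z -> holomorphic_at h z -> holomorphic_at (fun w => g w * h w) z.
Proof.
by apply: filterS2 => w gw hw; exact (@derivableM (CxF R) (CxF R) g h w 1 gw hw).
Qed.

Lemma holomorphic_cst {R : realType} (c z : Cx R) : holomorphic_at (fun _ => c) z.
Proof.
apply: filterE => w; exact (@derivable_cst (CxF R) (CxF R) (CxF R) c w 1).
Qed.

Lemma holomorphic_subr {R : realType} (z : Cx R) : holomorphic_at (fun w => w - z) z.
Proof.
apply: filterE => w.
exact (@derivableB (CxF R) (CxF R) (CxF R) id (cst z) w 1 (@derivable_id (CxF R) (CxF R) w 1)
  (@derivable_cst (CxF R) (CxF R) (CxF R) z w 1)).
Qed.

Lemma holomorphicX {R : realType} (g : Cx R -> Cx R) z n :
  holomorphic_at g z -> holomorphic_at (fun w => g w ^+ n) z.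
Proof.
move=> gz; elim: n => [|n IH].
  exact (holomorphic_cst 1 z).
have -> : (fun w => g w ^+ n.+1) = (fun w => g w * g w ^+ n).
  by apply: funext => w; rewrite exprS.
exact (holomorphicM gz IH).
Qed.

Lemma holomorphic_cvg {R : realType} (g : Cx R -> Cx R) z :
  holomorphic_at g z -> g w @[w --> z^'] --> g z.
Proof.
move=> /nbhs_singleton /derivable1_diffP gd.
exact (proj1 (continuous_withinNx g z) (differentiable_continuous gd)).
Qed.

(** Only the values off z are compared; continuity extends the equation to z,
    where the positive power vanishes. *)
Lemma holomorphic_zero {R : realType} (g h : Cx R -> Cx R) z n :
  holomorphic_at g z -> holomorphic_at h z ->
  (\forall w \near z^', g w = (w - z) ^+ n.+1 * h w) -> g z = 0.
Proof.
move=> gz hz gh.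
have kc := holomorphic_cvg (holomorphicM (holomorphicX n.+1 (holomorphic_subr z)) hz).
rewrite subrr expr0n mul0r in kc.
have gc := cvg_trans (near_eq_cvg gh) (holomorphic_cvg gz).
exact (cvg_unique (@norm_hausdorff _ _) (gc _) kc).
Qed.

Lemma order_atM {R : realType} (f g : Cx R -> Cx R) z k l :
  order_at f z k -> order_at g z l -> order_at (fun w => f w * g w) z (k + l).
Proof.
move=> [f1 [hf nf ef]] [g1 [hg ng eg]].
exists (fun w => f1 w * g1 w); split; first exact (holomorphicM hf hg).
  by rewrite mulf_neq0.
have nz : \forall w \near z^', w != z by exact: withinT.
apply: filterS3 nz ef eg => w wz -> ->.
by rewrite expfzDr ?subr_eq0 // mulrACA.
Qed.

Lemma order_at1 {R : realType} (z : Cx R) : order_at (fun _ => 1) z 0.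
Proof.
exists (fun _ => 1); split; [exact (holomorphic_cst 1 z)|exact: oner_neq0|].
by apply: filterE => w; rewrite expr0z mulr1.
Qed.

Lemma order_atX {R : realType} (f : Cx R -> Cx R) z k n :
  order_at f z k -> order_at (fun w => f w ^+ n) z (k *+ n).
Proof.
move=> fk; elim: n => [|n IH]; first exact (order_at1 z).
rewrite mulrS.
have -> : (fun w => f w ^+ n.+1) = (fun w => f w * f w ^+ n).
  by apply: funext => w; rewrite exprS.
exact (order_atM fk IH).
Qed.

Lemma order_at_prod {R : realType} (I : Type) (s : seq I)
    (f : I -> Cx R -> Cx R) z (k : I -> int) :
  (forall i, order_at (f i) z (k i)) ->
  order_at (fun w => \prod_(i <- s) f i w) z (\sum_(i <- s) k i).
Proof.
move=> fk; elim: s => [|i s IH].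
  rewrite big_nil; under eq_fun do rewrite big_nil.
  exact (order_at1 z).
rewrite big_cons; under eq_fun do rewrite big_cons.
exact (order_atM (fk i) IH).
Qed.

(** If f = (w - z)^(-n) g with n > 0 were holomorphic, then g = (w - z)^n f
    would vanish at z. *)
Lemma mero_holomorphic_atP {R : realType} (f : Cx R -> Cx R) z k :
  order_at f z k -> mero_holomorphic_at f z <-> 0 <= k.
Proof.
move=> [g [hg ng eg]]; split; last first.
  case: k eg => // n eg _.
  exists (fun w => (w - z) ^+ n * g w); split; last exact eg.
  exact (holomorphicM (holomorphicX n (holomorphic_subr z)) hg).
move=> [h [hh eh]]; case: k eg => // n eg.
have nz : \forall w \near z^', w != z by exact: withinT.
case/negP: ng; apply/eqP; apply: (holomorphic_zero (n := n) hg hh).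
apply: filterS3 nz eg eh => w wz E <-.
by rewrite E NegzE -exprnN mulrA divff ?mul1r // expf_neq0 ?subr_eq0.
Qed.

Lemma order_at_exprz {R : realType} (z : Cx R) k :
  order_at (fun w => (w - z) ^ k) z k.
Proof.
exists (fun _ => 1); split; [exact (holomorphic_cst 1 z)|exact: oner_neq0|].
by apply: filterE => w; rewrite mulr1.
Qed.

(** The two orders are compared by twisting with (w - z)^(- k), which turns the
    first into 0 and the second into l - k. *)
Lemma order_at_le {R : realType} (f : Cx R -> Cx R) z k l :
  order_at f z k -> order_at f z l -> k <= l.
Proof.
move=> fk fl; rewrite -subr_ge0.
apply/(mero_holomorphic_atP (order_atM fl (order_at_exprz z (- k)))).
by apply/(mero_holomorphic_atP (order_atM fk (order_at_exprz z (- k)))); rewrite subrr.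
Qed.

Lemma order_at_unique {R : realType} (f : Cx R -> Cx R) z k l :
  order_at f z k -> order_at f z l -> k = l.
Proof.
by move=> fk fl; apply: le_anti; rewrite (order_at_le fk fl) (order_at_le fl fk).
Qed.

(** * The monoid of exponents of nonnegative weight *)

(** The linear form a_1 l_1 + ... + a_r l_r which cuts out H(s0) when l lists the
    orders of the f_j. *)
Definition weight (r : nat) (l : 'I_r -> int) (a : monom r) : int :=
  \sum_(j < r) l j *+ a j.

Lemma weight0 r (l : 'I_r -> int) : weight l (@mnm0 r) = 0.
Proof. by apply: big1 => j _; rewrite mnm0E. Qed.

Lemma weightD r (l : 'I_r -> int) (a b : monom r) :
  weight l (mnm_add a b) = weight l a + weight l b.
Proof.
by rewrite /weight -big_split; apply: eq_bigr => j _; rewrite mnmDE mulrnDr.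
Qed.

Lemma weight1 r (l : 'I_r -> int) (j : 'I_r) : weight l (mnm1 j) = l j.
Proof.
rewrite /weight (bigD1 j) //= mnm1E eqxx big1 ?addr0 // => k kj.
by rewrite mnm1E eq_sym (negbTE kj).
Qed.

Lemma weight_opp_mdeg r (l : 'I_r -> int) (v : monom r) :
  (forall k, (0 < v k)%N -> l k = -1) -> weight l v = - (mdeg v)%:Z.
Proof.
move=> lv; rewrite mdegE /weight -natz natr_sum -sumrN; apply: eq_bigr => k _.
by case: (posnP (v k)) => [->|/lv ->]; rewrite ?mulr0n ?oppr0 // mulNrn.
Qed.

Lemma mdeg_sub_exists r (b : monom r) n : (n <= mdeg b)%N ->
  exists2 v : monom r, (forall k, (v k <= b k)%N) & mdeg v = n.
Proof.
elim: n => [|n IH] nb; first by exists (@mnm0 r); [move=> k; rewrite mnm0E|exact: mdeg0].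
have [v vb vn] := IH (ltnW nb).
have /existsP[k vk] : [exists k, (v k < b k)%N].
  apply: contraLR nb; rewrite negb_exists => /forallP vb'.
  rewrite -leqNgt -vn !mdegE; apply: leq_sum => k _.
  by rewrite leqNgt.
exists (mnm_add (mnm1 k) v); last by rewrite mdegD mdeg1 vn.
move=> i; rewrite mnmDE mnm1E; case: eqP => [<-|_]; first exact: vk.
exact: vb.
Qed.

(** The monoid of exponents of nonnegative weight is generated by the unit vectors
    of weight 0 and the vectors e_j + v with l_j > 0, v supported on the negative
    weights (all equal to -1) and |v| <= l_j.  From an exponent a with a_j > 0 and
    l_j > 0 one splits off e_j + v with v <= a as large as the bound l_j permits: either the
    bound is reached, and the weight of a is unchanged, or v exhausts the negative
    part of a, and the rest has no negative contribution. *)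
Lemma weight_monoid_ind r (l : 'I_r -> int) (Q : monom r -> Prop) :
  (forall j, l j < 0 -> l j = -1) ->
  Q (@mnm0 r) ->
  (forall a b, Q a -> Q b -> Q (mnm_add a b)) ->
  (forall j, l j = 0 -> Q (mnm1 j)) ->
  (forall j (v : monom r), 0 < l j -> (forall k, (0 < v k)%N -> l k < 0) ->
    (mdeg v)%:Z <= l j -> Q (mnm_add (mnm1 j) v)) ->
  forall a, 0 <= weight l a -> Q a.
Proof.
move=> lN Q0 QD Qz Qp a.
have [n] := ubnP (mdeg a); elim: n a => // n IH a an wa.
have step (u c : monom r) : a = mnm_add u c -> (0 < mdeg u)%N ->
    0 <= weight l c -> Q u -> Q a.
  move=> aE u0 wc Qu; rewrite aE; apply: QD => //; apply: IH => //.
  by move: an; rewrite aE mdegD; lia.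
have [/existsP[j /andP[aj /eqP lj]]|no0] :=
  boolP [exists j, (0 < a j)%N && (l j == 0)].
  have aE : a = mnm_add (mnm1 j) (mnm_sub a (mnm1 j)).
    by apply/mnmP => i; rewrite mnmDE mnmBE mnm1E; case: eqP => [<-|_]; lia.
  apply: (step _ _ aE); rewrite ?mdeg1 //; last exact: Qz.
  by move: wa; rewrite {1}aE weightD weight1 lj add0r.
have [/existsP[j /andP[aj lj]]|noP] :=
  boolP [exists j, (0 < a j)%N && (0 < l j)]; last first.
  have aN k : (0 < a k)%N -> l k = -1.
    move=> ak; apply: lN; rewrite ltNge le_eqVlt; apply/negP => /orP[lk|lk].
      by case/negP: no0; apply/existsP; exists k; rewrite ak eq_sym.
    by case/negP: noP; apply/existsP; exists k; rewrite ak.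
  suff /eqP -> : a == @mnm0 r by [].
  by rewrite -mdeg_eq0; move: wa; rewrite weight_opp_mdeg // oppr_ge0 lez_nat leqn0.
(* The part of a on the coordinates of negative weight. *)
pose b : monom r := Multinom [tuple (if l k < 0 then a k else 0%N) | k < r].
have bk k : b k = if l k < 0 then a k else 0%N by exact: mnmE.
(* Either |v| = l_j, or |b| <= l_j and v = b. *)
have [v [vb vl vc]] : exists v : monom r, [/\ forall k, (v k <= b k)%N,
    (mdeg v)%:Z <= l j & (mdeg v)%:Z = l j \/ v = b].
  have [bl|/ltW lb] := leP (mdeg b)%:Z (l j).
    by exists b; split=> //; right.
  have [m lm] : exists m : nat, l j = m by exists `|l j|%N; rewrite gtz0_abs.
  rewrite lm lez_nat in lb *.
  by have [v vb vm] := mdeg_sub_exists lb; exists v; rewrite vm; split=> //; left.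
have vneg k : (0 < v k)%N -> l k < 0.
  by move=> vk; move: (leq_trans vk (vb k)); rewrite bk; case: ifP.
have va k : (v k <= a k)%N.
  by apply: leq_trans (vb k) _; rewrite bk; case: ifP.
have vj : v j = 0%N.
  by apply/eqP; rewrite -leqn0 leqNgt; apply/negP => /vneg; rewrite ltNge ltW.
pose c := mnm_sub (mnm_sub a (mnm1 j)) v.
have aE : a = mnm_add (mnm_add (mnm1 j) v) c.
  apply/mnmP => i; rewrite !mnmDE !mnmBE mnm1E; case: eqP (va i) => [<-|_]; lia.
apply: (step _ _ aE); rewrite ?mdegD ?mdeg1 //; last exact: Qp.
case: vc => [vE|vE].
  move: wa; rewrite {1}aE !weightD weight1 (weight_opp_mdeg (v := v)).
    by rewrite vE subrr add0r.
  by move=> k /vneg /lN.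
apply: sumr_ge0 => k _; rewrite !mnmBE vE bk.
have [lk|lk] := ltP (l k) 0; last exact: mulrn_wge0.
suff -> : (a k - (mnm1 j) k - a k = 0)%N by rewrite mulr0n.
lia.
Qed.

(** * Monoid algebras and generated subalgebras *)

(** A subset of the polynomial ring is a subalgebra, in terms of Prop-valued
    membership. *)
Lemma subalg_closed_setE (F : fieldType) r (A : set (mpolyring r F)) :
  GRing.subalg_closed (mem A) <->
  [/\ A 1, forall c u v, A u -> A v -> A (c *: u + v) &
      forall u v, A u -> A v -> A (u * v)].
Proof.
split=> [[A1 AL AM]|[A1 AL AM]]; split.
- exact: set_mem A1.
- by move=> c u v Au Av; apply: set_mem (AL c u v (mem_set Au) (mem_set Av)).
- by move=> u v Au Av; apply: set_mem (AM u v (mem_set Au) (mem_set Av)).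
- exact: mem_set.
- by move=> c u v Au Av; apply: mem_set; apply: AL; apply: set_mem.
- by move=> u v Au Av; apply: mem_set; apply: AM; apply: set_mem.
Qed.

Lemma submod_closed_setE (F : fieldType) (V : lmodType F) (A : set V) :
  GRing.submod_closed (mem A) <->
  (A 0 /\ forall c u v, A u -> A v -> A (c *: u + v)).
Proof.
split=> [[A0 AL]|[A0 AL]]; split.
- exact: set_mem A0.
- by move=> c u v Au Av; apply: set_mem (AL c u v (mem_set Au) (mem_set Av)).
- exact: mem_set.
- by move=> c u v Au Av; apply: mem_set; apply: AL; apply: set_mem.
Qed.

Lemma gen_subalg_closed (F : fieldType) r (X : set (mpolyring r F)) :
  GRing.subalg_closed (mem (gen_subalg X)).
Proof.
apply/subalg_closed_setE; split.
- by move=> A [/subalg_closed_setE[]].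
- move=> c u v Xu Xv A XA; case: (XA) => /subalg_closed_setE[_ AL _] _.
  by apply: AL; [exact: Xu|exact: Xv].
- move=> u v Xu Xv A XA; case: (XA) => /subalg_closed_setE[_ _ AM] _.
  by apply: AM; [exact: Xu|exact: Xv].
Qed.

(** Since monomials are linearly independent, F[H] consists of the polynomials all
    of whose monomials have their exponent in H. *)
Lemma monoid_algE (F : fieldType) r (H : set (monom r)) :
  monoid_alg F H = [set u | forall m, m \in msupp u -> H m].
Proof.
apply/seteqP; split.
  apply: smallest_sub.
    apply/submod_closed_setE; split=> [m|c u v Hu Hv m]; first by rewrite msupp0.
    move/msuppD_le; rewrite mem_cat => /orP[/msuppZ_le|]; [exact: Hu|exact: Hv].
  by move=> _ [a Ha <-] m; rewrite msuppX inE => /eqP ->.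
move=> u Hu A [/submod_closed_setE[A0 AL] XA]; rewrite [u]mpolyE.
rewrite big_seq; apply: (big_ind A) => //.
  by move=> x y Ax Ay; rewrite -[x]scale1r; apply: AL.
move=> m /Hu Hm; rewrite -[_ *: _]addr0; apply: AL => //.
by apply: XA; exists m.
Qed.

Lemma monoid_alg_closed (F : fieldType) r (H : set (monom r)) :
  H (@mnm0 r) -> (forall a b, H a -> H b -> H (mnm_add a b)) ->
  GRing.subalg_closed (mem (monoid_alg F H)).
Proof.
move=> H0 HD; apply/subalg_closed_setE; rewrite monoid_algE; split.
- by move=> m; rewrite msupp1 inE => /eqP ->.
- move=> c u v Hu Hv m /msuppD_le; rewrite mem_cat => /orP[/msuppZ_le|].
    exact: Hu.
  exact: Hv.
- move=> u v Hu Hv m /msuppM_le /allpairsP[[a b] /= [au bv ->]].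
  by apply: HD; [exact: Hu|exact: Hv].
Qed.

(** * The algebra of H(s0) *)

Lemma H_set_weight (R : realType) (r : nat) (f : 'I_r -> Cx R -> Cx R)
    (s0 : Cx R) (l : 'I_r -> int) :
  (forall j, order_at (f j) s0 (l j)) -> forall a, H_set f s0 a <-> 0 <= weight l a.
Proof.
move=> f_ord a; apply: mero_holomorphic_atP.
exact (order_at_prod (index_enum 'I_r) (fun j => order_atX (a j) (f_ord j))).
Qed.

Theorem proposition1p11 (R : realType)
  (K : splittingFieldType rat) (galK : galois 1%VS {:K}%VS)
  (r : nat) (chi : 'I_r -> {ffun gal_of {:K}%VS -> Cx R})
  (chi_irr : set_bij [set: 'I_r] (irr_complex_chars R K) chi)
  (f : 'I_r -> Cx R -> Cx R) (fL : forall j, is_artin_L (chi j) (f j))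
  (s0 : Cx R) (s0_neq1 : s0 <> 1)
  (l : 'I_r -> int) (f_ord : forall j, order_at (f j) s0 (l j))
  (F : fieldType) (ev : F -> Cx R -> Cx R) (F_mero : mero_subfield_lt1 ev)
  (artin_fails : ~ (forall j, mero_holomorphic_at (f j) s0))
  (p q : nat) (p_gt0 : (1 <= p)%N) (p_lt_q : (p < q)%N) (q_le_r : (q <= r)%N)
  (l_pos : forall j : 'I_r, (j < p)%N -> 0 < l j)
  (l_neg : forall j : 'I_r, (p <= j < q)%N -> l j < 0)
  (l_zero : forall j : 'I_r, (q <= j)%N -> l j = 0)
  (poles_simple : forall j : 'I_r, (p <= j < q)%N -> simple_pole (f j) s0) :
  monoid_alg F (H_set f s0) =
  gen_subalg
    ([set mvar F k | k in [set k : 'I_r | (q <= k)%N]] `|`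
     [set g | exists (j : 'I_r) (v : monom r),
        [/\ (j < p)%N,
            forall k : 'I_r, k \in mon_supp v -> (p <= k < q)%N,
            (mdeg v)%:Z <= l j &
            g = mvar F j * mmono F v]]).
Proof.
have HE := H_set_weight f_ord.
have lN j : l j < 0 -> (p <= j < q)%N.
  move=> lj; have [jp|pj] := ltnP j p.
    by move: (l_pos j jp); rewrite ltNge ltW.
  by have [//|qj] := ltnP j q; move: lj; rewrite l_zero // ltxx.
have lN1 j : l j < 0 -> l j = -1.
  move=> /lN /poles_simple; exact (order_at_unique (f_ord j)).
apply/seteqP; split; apply: smallest_sub.
- exact: GRing.subalg_closedZ (gen_subalg_closed _).
- set X := (X in gen_subalg X).
  have /subalg_closed_setE[G1 _ GM] := @gen_subalg_closed F r X.
  move=> _ [a /HE wa <-].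
  (* Membership of monomials is checked on the generators of the monoid. *)
  apply: (weight_monoid_ind (l := l)
    (Q := fun a => gen_subalg X (mmono F a))) wa => [//||b c Hb Hc|j lj|j v lj vN vd].
  + by rewrite mpolyX0.
  + by rewrite mpolyXD; apply: GM.
  + apply: sub_gen_smallest; left; exists j => //=; rewrite leqNgt.
    apply/negP => jq; have [jp|pj] := ltnP j p.
      by move: (l_pos j jp); rewrite lj ltxx.
    by move: (l_neg j); rewrite pj jq lj ltxx => /(_ isT).
  + apply: sub_gen_smallest; right; exists j, v; split=> //; last exact: mpolyXD.
      rewrite ltnNge; apply/negP => pj; have [jq|qj] := ltnP j q.
        by move: (l_neg j); rewrite pj jq => /(_ isT) /ltW; rewrite leNgt lj.
      by move: lj; rewrite l_zero // ltxx.
    by move=> k; rewrite inE => /vN /lN.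
- apply: monoid_alg_closed => [|a b /HE wa /HE wb]; apply/HE.
    by rewrite weight0.
  by rewrite weightD addr_ge0.
- rewrite monoid_algE => _ [[k /= qk <-]|[j [v [jp vN vd ->]]]] m.
    by rewrite msuppX inE => /eqP ->; apply/HE; rewrite weight1 l_zero.
  rewrite -mpolyXD msuppX inE => /eqP ->; apply/HE.
  rewrite weightD weight1 weight_opp_mdeg ?subr_ge0 // => k vk.
  by apply: lN1; apply: l_neg; apply: vN; rewrite inE.
Qed.
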